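(* Let $\aleph_1\le\kappa\le\lambda\le\mathfrak c$ be cardinals. Suppose there exist a separable metric space $(X,d_X)$ of cardinality $\lambda$, a metric space $(Y,d_Y)$, and a continuous function $f:X\to Y$ such that for no subset $A\subseteq X$ of cardinality $\kappa$ is the restriction $f|A$ uniformly continuous. Then there exists a $\kappa$-$K$-Lusin set of cardinality $\lambda$ in some Polish space and, consequently, $C_9(\lambda,\kappa)$ holds true.
   Context: $\mathfrak c=2^{\aleph_0}$. For a cardinal $\aleph_1\le\kappa\le\mathfrak c$, an uncountable subset $E$ of a Polish space $P$ is a $\kappa$-$K$-Lusin set in $P$ if $|E\cap K|<\kappa$ for every compact set $K\subseteq P$. $C_9(\lambda,\kappa)$ is the statement: there exists a set $E\subseteq\mathbb R$ of cardinality $\lambda$ (equivalently: for any set $E\subseteq\mathbb R$ of cardinality $\lambda$) there is a sequence of functions $f_n:E\to\mathbb R$ converging pointwise on $E$ but not converging uniformly on any subset of $E$ of cardinality $\kappa$. *)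

(* Defs.v *)
From HB Require Import structures.
From mathcomp Require Import all_boot all_order all_algebra.
From mathcomp Require Import all_classical all_reals all_analysis.

Set Implicit Arguments.
Unset Strict Implicit.
Unset Printing Implicit Defensive.

Import Order.TTheory GRing.Theory Num.Theory.
Import numFieldTopology.Exports numFieldNormedType.Exports.

Local Open Scope classical_set_scope.
Local Open Scope card_scope.
Local Open Scope ring_scope.

(* The library has no type of cardinals: a cardinal kappa is represented by an
   arbitrary type of that cardinality and enters statements only through the
   comparison of [set: kappa] with other sets. *)

Definition card_lt T U (A : set T) (B : set U) : Prop :=
  A #<= B /\ ~ (B #<= A).

(* As aleph_1 is the successor of aleph_0, aleph_1 <= kappa means that kappa
   is uncountable. *)
Definition aleph1_le (kappa : Type) : Prop := ~ countable [set: kappa].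

Definition le_continuum (kappa : Type) : Prop :=
  [set: kappa] #<= [set: nat -> bool].

Definition separable (T : topologicalType) : Prop :=
  exists D : set T, countable D /\ dense D.

(* The library's completeType also requires a distinguished point; this is its
   axiom without that requirement. *)
Definition complete_uniform (T : uniformType) : Prop :=
  forall F : set_system T, ProperFilter F -> cauchy F -> exists x : T, F --> x.

Definition homeomorphic (S T : topologicalType) : Prop :=
  exists (h : S -> T) (k : T -> S),
    [/\ cancel h k, cancel k h, continuous h & continuous k].

Definition completely_metrizable (R : realType) (P : topologicalType) : Prop :=
  exists M : metricType R, complete_uniform M /\ homeomorphic P M.

Definition polish (R : realType) (P : topologicalType) : Prop :=
  separable P /\ completely_metrizable R P.

Definition K_lusin (kappa : Type) (P : topologicalType) (E : set P) : Prop :=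
  ~ countable E /\
  forall K : set P, compact K -> card_lt (E `&` K) [set: kappa].

Definition uniformly_convergent_on (R : realType) (T : choiceType) (A : set T)
    (f : nat -> T -> R) : Prop :=
  exists g : T -> R, {uniform A, f @ \oo --> g}.

Definition C9 (R : realType) (lambda kappa : Type) : Prop :=
  exists E : set R, E #= [set: lambda] /\
  exists f : nat -> E -> R,
    (forall x : E, cvgn (fun n => f n x)) /\
    (forall A : set E, A #= [set: kappa] -> ~ uniformly_convergent_on A f).

(* Main.v *)
Require Import Defs.
From HB Require Import structures.
From mathcomp Require Import all_boot all_order all_algebra.
From mathcomp Require Import lra.
From mathcomp Require Import all_classical all_reals all_analysis.
Import Order.TTheory GRing.Theory Num.Theory.
Import numFieldTopology.Exports numFieldNormedType.Exports.
Local Open Scope classical_set_scope.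
Local Open Scope card_scope.
Local Open Scope ring_scope.

(** The proof rests on one observation.  Choose for [f] a pointwise modulus of
    continuity, that is, functions [m x j] of the point [x] such that points
    within [1 / (m x j + 1)] of [x] have images within [1 / (j + 1)] of [f x]
    ([continuous_modulus]).  On a set where each [x |-> m x j] is bounded, a
    set called tame below, [f] is uniformly continuous
    ([modulus_unif_continuous]).  By hypothesis a tame set therefore contains
    no set of cardinality [kappa], and both conclusions follow from this
    property of [m] alone.

    A compact subset of the Baire space of sequences of natural numbers is
    bounded in each coordinate ([compact_tame]).  Hence under any injection of
    [X] into the Baire space whose even coordinates are the [m x j], the
    preimage of a compact set is tame, and the image of [X] is the required
    Lusin set ([K_lusin_of_tame]).  As [X] has at most the cardinality of the
    continuum, the odd coordinates can encode [x], which makes the map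
    injective.  That the intersection with a compact set has cardinality less
    than [kappa], and not merely a cardinality that [kappa] does not exceed,
    is the comparability of cardinals ([card_le_total]).

    For the sequence of functions, let [f_n x = 1 / (k + 1)], where [k] is the
    least index [j < n] with [m x j > n], or [n] if there is none.  It tends
    to [0] at every point, and if it converges uniformly on [A], then for each
    [j] some [n] satisfies [f_n < 1 / (j + 1)] on [A], so [m x j <= n] there:
    [A] is tame ([uniform_escape_tame]).  These functions are transported to a
    set of reals by an embedding of the continuum into the line
    ([ternary_inj]). *)

(** * Comparing cardinals *)

(** A total relation from [A] to [B], possibly many-valued, whose values at
    distinct points are distinct, bounds the cardinality of [A]. *)
Lemma card_le_rel {T U : Type} {A : set T} {B : set U} (G : T -> U -> Prop) :
  (forall a, A a -> exists2 b, B b & G a b) ->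
  (forall a a' b, G a b -> G a' b -> a = a') -> A #<= B.
Proof.
move=> Gtot Ginj.
have /choice[h hG] : forall a : A, exists b : B, G (val a) (val b).
  move=> [a /= /set_mem /Gtot[b Bb Gab]].
  by exists (exist _ b (mem_set Bb)).
apply/card_leP/injfunPex; exists h => // a a' _ _ haa'.
apply/val_inj/(Ginj _ _ (val (h a))); first exact: hG.
by rewrite haa'; exact: hG.
Qed.

(** Any two cardinals are comparable: a maximal injective partial function
    from [A] to [B] has domain [A] or range [B]. *)
Lemma card_le_total {T U : Type} (A : set T) (B : set U) :
  A #<= B \/ B #<= A.
Proof.
pose P (G : set (T * U)) :=
  [/\ G `<=` A `*` B,
      forall a b b', G (a, b) -> G (a, b') -> b = b' &
      forall a a' b, G (a, b) -> G (a', b) -> a = a'].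
have [F FP Ftot|G [[GAB Gfun Ginj] Gmax]] := @Zorn_bigcup _ P.
  split.
  - by move=> x [G FG Gx]; have [+ _ _] := FP _ FG; exact.
  - move=> a b b' [G FG Gab] [G' FG' Gab'].
    have [_ Gfun _] := FP _ FG; have [_ G'fun _] := FP _ FG'.
    by have [GG'|G'G] := Ftot _ _ FG FG';
      [apply: (G'fun a) => //; exact: GG'|apply: (Gfun a) => //; exact: G'G].
  - move=> a a' b [G FG Gab] [G' FG' Gab'].
    have [_ _ Ginj] := FP _ FG; have [_ _ G'inj] := FP _ FG'.
    by have [GG'|G'G] := Ftot _ _ FG FG';
      [apply: (G'inj _ _ b) => //; exact: GG'
      |apply: (Ginj _ _ b) => //; exact: G'G].
have [Gdom|/existsNP[a0 /not_implyP[Aa0 Ga0]]] :=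
    pselect (forall a, A a -> exists2 b, B b & G (a, b)).
  by left; apply: (card_le_rel (fun a b => G (a, b))).
right; apply: (card_le_rel (fun b a => G (a, b))) => [b Bb|b b' a]; last first.
  exact: Gfun.
apply: contrapT => Gb.
have Ga0N b' : ~ G (a0, b').
  by move=> Ga0b'; apply: Ga0; exists b' => //; have [] := GAB _ Ga0b'.
have GbN a' : ~ G (a', b).
  by move=> Ga'b; apply: Gb; exists a' => //; have [] := GAB _ Ga'b.
apply: (Gmax (G `|` [set (a0, b)])).
  split=> [x Gx|sub]; first by left.
  by apply: (Ga0N b); apply: sub; right.
split.
- by move=> x [/GAB//|->].
- move=> a b1 b2 [G1|[e1 e1']] [G2|[e2 e2']].
  + exact: Gfun G1 G2.
  + by subst; case: (Ga0N b1).
  + by subst; case: (Ga0N b2).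
  + by subst.
- move=> a1 a2 b' [G1|[e1 e1']] [G2|[e2 e2']].
  + exact: Ginj G1 G2.
  + by subst; case: (GbN a1).
  + by subst; case: (GbN a2).
  + by subst.
Qed.

Lemma card_lt_of_not_le {T U : Type} (A : set T) (B : set U) :
  ~ (B #<= A) -> card_lt A B.
Proof. by move=> BA; split=> //; have [|/BA] := card_le_total A B. Qed.

Lemma card_setT_inj {T U : Type} :
  [set: T] #<= [set: U] -> exists h : T -> U, injective h.
Proof.
move=> /card_leP/injfunPex[h _ hinj].
exists (fun t => val (h (exist _ t (mem_set I)))) => t t' /val_inj.
by move=> /hinj; rewrite !in_setT => /(_ isT isT) [].
Qed.

(** * The continuum embeds into the reals *)

Section ternary.
Context {R : realType}.
Implicit Types b : nat -> bool.

(** The partial sums of the series with terms [b i / 3 ^ i]. *)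
Let s b n : R := \sum_(i < n) (b i)%:R * 3^-1 ^+ i.

Let sS b n : s b n.+1 = s b n + (b n)%:R * 3^-1 ^+ n.
Proof. by rewrite /s big_ord_recr. Qed.

Let s_nondecreasing b m n : (m <= n)%N -> s b m <= s b n.
Proof.
move=> /subnK <-; elim: (n - m)%N => [|k IH]; first by rewrite add0n.
by rewrite addSn sS (le_trans IH)// lerDl mulr_ge0// exprn_ge0.
Qed.

(* The quantity [s b n + (3 / 2) / 3 ^ n] bounds all partial sums because it
   is nonincreasing in [n]. *)
Let s_tail b m n : (m <= n)%N -> s b n <= s b m + 3 / 2 * 3^-1 ^+ m.
Proof.
move=> mn; apply: (@le_trans _ _ (s b n + 3 / 2 * 3^-1 ^+ n)).
  by rewrite lerDl mulr_ge0// exprn_ge0.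
move: mn => /subnK <-; elim: (n - m)%N => [|k IH]; first by rewrite add0n.
apply: le_trans IH; rewrite addSn sS exprS -addrA lerD2l.
have : 0 <= (3^-1 : R) ^+ (k + m) by rewrite exprn_ge0.
by case: (b _); rewrite /=; lra.
Qed.

Let s_has_sup b : has_sup (range (s b)).
Proof.
split; first by exists (s b 0%N), 0%N.
by exists (s b 0%N + 3 / 2 * 3^-1 ^+ 0) => _ [n _ <-]; exact: s_tail.
Qed.

(** The real number whose ternary expansion has the digits 0 and 1 prescribed
    by [b]; since the digit 2 is avoided, it determines [b]. *)
Definition ternary b : R := sup (range (s b)).

Let ternary_lt b b' k : (forall i, (i < k)%N -> b i = b' i) ->
  b k -> ~~ b' k -> ternary b' < ternary b.
Proof.
move=> bb' bk b'k.
have sbb' : s b k = s b' k by apply: eq_bigr => i _; rewrite bb'.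
have le1 : s b k.+1 <= ternary b.
  by apply: ub_le_sup; [have [] := s_has_sup b|exists k.+1].
have le2 : ternary b' <= s b' k.+1 + 3 / 2 * 3^-1 ^+ k.+1.
  apply: ge_sup; first by have [] := s_has_sup b'.
  move=> _ [n _ <-]; have [kn|/ltnW nk] := leqP k.+1 n; first exact: s_tail.
  by rewrite (le_trans (s_nondecreasing _ _ _ nk))// lerDl mulr_ge0//.
apply: le_lt_trans le2 (lt_le_trans _ le1).
rewrite !sS sbb' bk (negbTE b'k) exprS.
have : 0 < (3^-1 : R) ^+ k by rewrite exprn_gt0.
by rewrite /=; lra.
Qed.

Lemma ternary_inj : injective ternary.
Proof.
move=> b b' Fbb'; apply: contrapT => bb'.
have /existsNP[j /eqP bj] : ~ forall i, b i = b' i by move=> /funext.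
have [k bk kmin] := ex_minnP (ex_intro (fun i => b i != b' i) j bj).
have agree i : (i < k)%N -> b i = b' i.
  by move=> ik; apply/eqP; apply: contraTT ik => /kmin; rewrite -leqNgt.
move: bk; case: (boolP (b k)) => bk; case: (boolP (b' k)) => b'k // _.
- by have := ternary_lt _ _ _ agree bk b'k; rewrite Fbb' ltxx.
- have agree' i : (i < k)%N -> b' i = b i by move=> /agree.
  by have := ternary_lt _ _ _ agree' b'k bk; rewrite Fbb' ltxx.
Qed.

End ternary.

(** * Moduli of continuity *)

Lemma invS_lt {R : realType} (e : R) : 0 < e -> exists n, n.+1%:R^-1 < e.
Proof.
move=> e0; have [n _ nP] := near_infty_natSinv_lt (PosNum e0).
by exists n; exact: nP (leqnn n).
Qed.

(** A pointwise modulus of continuity of [f]: the ball of radius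
    [1 / (m x j + 1)] about [x] is mapped into the ball of radius
    [1 / (j + 1)] about [f x]. *)
Definition modulus {R : realType} {X Y : metricType R} (f : X -> Y)
    (m : X -> nat -> nat) : Prop :=
  forall x j y, mdist x y < (m x j).+1%:R^-1 -> mdist (f x) (f y) < j.+1%:R^-1.

Lemma continuous_modulus {R : realType} {X Y : metricType R} (f : X -> Y) :
  continuous f -> exists m, modulus f m.
Proof.
move=> fcont; have mex (xj : X * nat) : exists k : nat, forall y : X,
    mdist xj.1 y < k.+1%:R^-1 -> mdist (f xj.1) (f y) < xj.2.+1%:R^-1.
  case: xj => x j /=.
  have /fcont : nbhs (f x) (ball (f x) (j.+1%:R^-1 : R)).
    by apply: nbhsx_ballx; rewrite invr_gt0.
  move=> /nbhs_ballP[e /= e0 xe]; have [k ke] := invS_lt e e0.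
  exists k => y xy; have := xe y; rewrite !ballEmdist; apply.
  exact: lt_trans ke.
have [m mP] := choice mex.
by exists (fun x j => m (x, j)) => x j; exact: (mP (x, j)).
Qed.

(** A set of points is tame for a family [m] of integer-valued functions if
    every one of these functions is bounded on it. *)
Definition tame {X : Type} (m : X -> nat -> nat) (A : set X) : Prop :=
  forall j, exists N, forall x, A x -> (m x j <= N)%N.

Lemma tame_subset {X : Type} {m : X -> nat -> nat} {A B : set X} :
  A `<=` B -> tame m B -> tame m A.
Proof. by move=> AB mB j; have [N NB] := mB j; exists N => x /AB/NB. Qed.

(** On a tame set the radii given by the modulus can be chosen independently of
    the point. *)
Lemma modulus_unif_continuous {R : realType} {X Y : metricType R} {f : X -> Y}
    {m : X -> nat -> nat} {A : set X} :
  modulus f m -> tame m A -> unif_continuous (f : subspace A -> Y).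
Proof.
move=> fm mA V; rewrite -entourage_ballE => -[e /= e0 eV].
have [j je] := invS_lt e e0; have [N NA] := mA j.
exists [set xy | ball xy.1 (N.+1%:R^-1 : R) xy.2].
  by rewrite -entourage_ballE; exists N.+1%:R^-1 => //=; rewrite invr_gt0.
move=> [x y] /= [<-|[Ax [Ay]]].
  by apply: eV; exact: ballxx.
rewrite ballEmdist /= => xy; apply: eV; rewrite /= ballEmdist /=.
apply: lt_trans je; apply: fm.
apply: lt_le_trans xy _; rewrite lef_pV2 ?posrE// ler_nat ltnS.
exact: NA.
Qed.

(** * The Baire space *)

(** The Baire space of sequences of natural numbers, with the distance
    [1 / (k + 1)] between two sequences that first differ at index [k].  The
    parameter [R] is the field in which this distance takes its values. *)
Definition baire (R : realType) : Type := nat -> nat.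

HB.instance Definition _ (R : realType) := Choice.on (baire R).

Section baire_metric.
Context {R : realType}.
Implicit Types x y z : baire R.

Let neq_ex x y : x <> y -> exists k, x k != y k.
Proof.
move=> xy; apply: contrapT => /forallNP xyE; apply: xy; apply/funext => k.
by apply/eqP; apply: contrapT => /negP; exact: xyE.
Qed.

(** The distance from [x] to [y]: the inverse of one plus the first index at
    which they differ, and [0] when they are equal. *)
Definition baire_dist x y : R :=
  if pselect (x = y) is right xy then (ex_minn (neq_ex x y xy)).+1%:R^-1 else 0.

Let dist_xx x : baire_dist x x = 0.
Proof. by rewrite /baire_dist; case: pselect. Qed.

Let dist_ge0 x y : 0 <= baire_dist x y.
Proof. by rewrite /baire_dist; case: pselect. Qed.

Let dist_diff x y : x <> y -> exists2 k,
  x k != y k & baire_dist x y = k.+1%:R^-1.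
Proof.
rewrite /baire_dist; case: pselect => // xy _.
by case: ex_minnP => k xk _; exists k.
Qed.

Let dist_lower x y k : x k != y k -> k.+1%:R^-1 <= baire_dist x y.
Proof.
rewrite /baire_dist; case: pselect => [->|xy xyk]; first by rewrite eqxx.
case: ex_minnP => i _ /(_ _ xyk) ik.
by rewrite lef_pV2 ?posrE// ler_nat ltnS.
Qed.

Lemma baire_dist_lt x y n :
  baire_dist x y < n.+1%:R^-1 <-> forall i, (i <= n)%N -> x i = y i.
Proof.
split=> [xy i ni|xy].
  apply/eqP; apply: contraTT xy => /dist_lower xyi; rewrite -leNgt.
  by apply: le_trans xyi; rewrite lef_pV2 ?posrE// ler_nat ltnS.
have [->|/dist_diff[k xyk ->]] := pselect (x = y); first by rewrite dist_xx.
rewrite ltf_pV2 ?posrE// ltr_nat ltnS ltnNge; apply: contra xyk => kn.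
exact/eqP/xy.
Qed.

Let dist_positivity x y : baire_dist x y = 0 -> x = y.
Proof.
move=> xy0; apply: contrapT => /dist_diff[k _]; rewrite xy0 => /eqP.
by rewrite eq_sym invr_eq0 pnatr_eq0.
Qed.

Let dist_sym x y : baire_dist x y = baire_dist y x.
Proof.
suff le u v : baire_dist u v <= baire_dist v u.
  by apply/eqP; rewrite eq_le !le.
have [->//|/dist_diff[k uvk ->]] := pselect (u = v).
by apply: dist_lower; rewrite eq_sym.
Qed.

Let dist_triangle y x z :
  baire_dist x z <= baire_dist x y + baire_dist y z.
Proof.
have [->|/dist_diff[k xzk ->]] := pselect (x = z).
  by rewrite dist_xx addr_ge0.
(* At the first index where [x] and [z] differ, [y] differs from one of them. *)
have [xyk|/dist_lower xyk] := eqVneq (x k) (y k); last first.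
  by rewrite (le_trans xyk)// lerDl.
by rewrite (@le_trans _ _ (baire_dist y z))// ?lerDr// dist_lower// -xyk.
Qed.

HB.instance Definition _ := @isMetric.Build R (baire R) baire_dist
  dist_xx dist_positivity dist_sym dist_triangle.

Lemma baire_ballE x n :
  ball x (n.+1%:R^-1 : R) = [set y | forall i, (i <= n)%N -> x i = y i].
Proof.
by rewrite ballEmdist; apply/seteqP; split=> y /= /baire_dist_lt.
Qed.

Lemma baire_nbhs x n :
  nbhs x [set y : baire R | forall i, (i <= n)%N -> x i = y i].
Proof. by rewrite -baire_ballE; apply: nbhsx_ballx; rewrite invr_gt0. Qed.

Lemma baire_nbhsP x (A : set (baire R)) : nbhs x A ->
  exists n, [set y | forall i, (i <= n)%N -> x i = y i] `<=` A.
Proof.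
move=> /nbhs_ballP[e /= e0 eA]; have [n ne] := invS_lt e e0.
by exists n; rewrite -baire_ballE; apply: subset_trans eA; apply/le_ball/ltW.
Qed.

(** The eventually zero sequences are dense. *)
Lemma baire_separable : separable (baire R).
Proof.
exists (range (fun s : seq nat => nth 0%N s : baire R)); split.
  exact: (card_le_trans (card_image_le _ _) (countableP _)).
move=> O [x Ox] Oopen.
have [n nO] := baire_nbhsP x O (open_nbhs_nbhs (conj Oopen Ox)).
exists (nth 0%N (mkseq x n.+1)); split; last by exists (mkseq x n.+1).
by apply: nO => i ni; rewrite nth_mkseq.
Qed.

(** The limit of a Cauchy filter is found coordinate by coordinate: each
    coordinate is constant on some member of the filter. *)
Lemma baire_complete : complete_uniform (baire R).
Proof.
move=> F FF /cauchy_ballP Fc.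
have coord k : exists a, F [set y : baire R | y k = a].
  have kpos : 0 < (k.+1%:R^-1 : R) by rewrite invr_gt0.
  have [[A B] [/= FA FB] AB] := Fc _ kpos.
  have [y By] := filter_ex FB; exists (y k); apply: filterS FA => x Ax.
  by have := AB (x, y) (conj Ax By); rewrite /= baire_ballE; exact.
have [a aP] := choice coord.
exists (a : baire R) => A /baire_nbhsP[n nA].
apply: (filterS nA); rewrite /=.
elim: n {nA} => [|n IH].
  by apply: filterS (aP 0%N) => y /= y0 i; rewrite leqn0 => /eqP ->.
apply: filterS2 IH (aP n.+1) => y /= yn yn1 i.
by rewrite leq_eqVlt ltnS => /orP[/eqP ->//|/yn].
Qed.

(** A compact set of sequences is bounded in each coordinate, because
    coordinates are locally constant. *)
Lemma compact_tame (K : set (baire R)) : compact K -> tame id K.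
Proof.
move=> /compact_near_coveringP Kcover j.
have [|N _ NK] := Kcover nat \oo (fun N (x : baire R) => (x j <= N)%N) _.
  move=> x Kx.
  exists ([set y | forall i, (i <= j)%N -> x i = y i], [set N | (x j <= N)%N]).
    by split; [exact: baire_nbhs|exists (x j)].
  by move=> [y N] /= [/(_ j (leqnn j)) <-].
exists N => x Kx.
exact: (NK N (leqnn N)).
Qed.

End baire_metric.

(** * A sequence that converges uniformly only on tame sets *)

(** The least index [j] with [n < s j], or [n] if there is none below [n]. *)
Definition escape_index (s : nat -> nat) (n : nat) : nat :=
  find (fun j => n < s j)%N (iota 0 n).

Lemma escape_index_le s n j : (j < escape_index s n)%N -> (s j <= n)%N.
Proof.
move=> js; rewrite leqNgt; have := before_find 0%N js.
rewrite nth_iota ?add0n => [->//|].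
by apply: leq_trans js _; rewrite -[leqRHS](size_iota 0); exact: find_size.
Qed.

Lemma escape_index_ge s j : exists N, forall n, (N <= n)%N ->
  (j <= escape_index s n)%N.
Proof.
exists (maxn j (\max_(i < j) s i)) => n; rewrite geq_max => /andP[jn sn].
rewrite leqNgt; apply/negP => ej.
have en : has (fun i => n < s i)%N (iota 0 n).
  by rewrite has_find size_iota (leq_trans ej).
have := nth_find 0%N en.
rewrite -/(escape_index s n) nth_iota ?add0n; last first.
  exact: leq_trans ej jn.
rewrite ltnNge => /negP; apply; apply: leq_trans sn.
exact: (leq_bigmax (Ordinal ej)).
Qed.

Lemma escape_cvg {R : realType} (s : nat -> nat) :
  (fun n => (escape_index s n).+1%:R^-1 : R) @ \oo --> (0 : R).
Proof.
apply/cvgrPdist_lt => e e0; have [j je] := invS_lt e e0.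
have [N sN] := escape_index_ge s j; exists N => // n /= /sN jn.
rewrite sub0r normrN ger0_norm//; apply: le_lt_trans je.
by rewrite lef_pV2 ?posrE// ler_nat ltnS.
Qed.

(** Whatever its limit, a uniformly convergent sequence is uniformly close to
    its pointwise limit [0] from some index [N] on, and escape indices larger
    than [j] at step [N] mean that [m x j] is at most [N]. *)
Lemma uniform_escape_tame {R : realType} {T : choiceType} {m : T -> nat -> nat}
    {A : set T} :
  uniformly_convergent_on A
    (fun n x => (escape_index (m x) n).+1%:R^-1 : R) -> tame m A.
Proof.
move=> [g fg] j.
pose e : R := j.+1%:R^-1 / 3; have e0 : 0 < e by rewrite divr_gt0 ?invr_gt0.
have [|N _ NP] := fg [set h | forall x, A x -> ball (g x) e (h x)].
  apply/uniform_nbhs; exists [set xy | ball xy.1 e xy.2]; split => //.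
  by rewrite -entourage_ballE; exists e.
exists N => x Ax; apply: escape_index_le.
(* The value at [x] is small for some index beyond [N], where it differs by
   less than [2 e] from the value at [N]. *)
have [M _ MP] := (cvgrPdist_lt _ _).1 (escape_cvg (R := R) (m x)) e e0.
have := NP N (leqnn N) x Ax; have := NP (maxn N M) (leq_maxl N M) x Ax.
have := MP (maxn N M) (leq_maxr N M).
rewrite /ball /= sub0r normrN ger0_norm//.
set a := (escape_index _ (maxn N M)).+1%:R^-1.
set b : R := (escape_index _ N).+1%:R^-1 => ae.
rewrite !ltr_distl => /andP[_ ga] /andP[gb _].
have : b < j.+1%:R^-1.
  have -> : j.+1%:R^-1 = 3 * e by rewrite /e mulrC divfK.
  by lra.
by rewrite /b ltf_pV2 ?posrE// ltr_nat ltnS.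
Qed.

(** The set of reals is a copy of [X], to which the functions above are
    transported. *)
Lemma C9_of_tame {R : realType} {kappa lambda X : Type} (m : X -> nat -> nat) :
  [set: X] #= [set: lambda] -> le_continuum lambda ->
  (forall B, tame m B -> ~ ([set: kappa] #<= B)) -> C9 R lambda kappa.
Proof.
move=> Xl lc mB.
have [psi psi_inj] : exists psi : X -> nat -> bool, injective psi.
  by apply: card_setT_inj; rewrite (card_le_eql Xl).
pose iota x : R := ternary (psi x).
have iota_inj : injective iota by move=> x y /ternary_inj/psi_inj.
exists (range iota); split.
  by rewrite (card_eql (inj_card_eq _))// => x y _ _; exact: iota_inj.
have /choice[h hP] : forall r : range iota, exists x, iota x = val r.
  by move=> [r /= /set_mem[x _ <-]]; exists x.
have h_inj : injective h by move=> r r' hr; apply: val_inj; rewrite -!hP hr.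
exists (fun n r => (escape_index (m (h r)) n).+1%:R^-1); split.
  by move=> r; apply/cvg_ex; exists 0; exact: escape_cvg.
move=> A Ak /(@uniform_escape_tame _ _ (m \o h)) mA.
apply: (mB (h @` A)).
  by move=> j; have [N NA] := mA j; exists N => _ [r /NA ? <-].
rewrite (card_le_eqr (inj_card_eq _)) => [|r r' _ _]; last exact: h_inj.
by rewrite -(card_le_eql Ak).
Qed.

(** * A Lusin set in the Baire space *)

(** The sequence alternating between the values of [s] and the digits of
    [b]. *)
Definition interleave (s : nat -> nat) (b : nat -> bool) (n : nat) : nat :=
  if odd n then nat_of_bool (b n./2) else s n./2.

Lemma interleave_even s b j : interleave s b j.*2 = s j.
Proof. by rewrite /interleave odd_double doubleK. Qed.

Lemma interleave_odd s b j : interleave s b j.*2.+1 = b j.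
Proof. by rewrite /interleave /= odd_double uphalf_double. Qed.

Lemma baire_polish (R : realType) : polish R (baire R).
Proof.
split; first exact: baire_separable.
exists (baire R); split; first exact: baire_complete.
by exists id, id; split=> // x.
Qed.

Lemma K_lusin_of_tame {R : realType} {kappa lambda X : Type}
    (m : X -> nat -> nat) :
  aleph1_le kappa -> [set: kappa] #<= [set: lambda] ->
  [set: X] #= [set: lambda] -> le_continuum lambda ->
  (forall B, tame m B -> ~ ([set: kappa] #<= B)) ->
  exists E : set (baire R), K_lusin kappa E /\ E #= [set: lambda].
Proof.
move=> k1 kl Xl lc mB.
have [psi psi_inj] : exists psi : X -> nat -> bool, injective psi.
  by apply: card_setT_inj; rewrite (card_le_eql Xl).
pose theta x : baire R := interleave (m x) (psi x).
have theta_inj : injective theta.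
  move=> x y xy; apply/psi_inj/funext => j.
  have := congr1 (fun s : baire R => s j.*2.+1) xy.
  by rewrite /theta !interleave_odd; case: (psi x j) (psi y j) => [] [].
have El : range theta #= [set: lambda].
  by rewrite (card_eql (inj_card_eq _))// => x y _ _; exact: theta_inj.
exists (range theta); split=> //; split.
  by move=> Ec; apply: k1; apply: card_le_trans kl _; rewrite -(card_le_eql El).
move=> K /compact_tame Kt; apply: card_lt_of_not_le => kK.
apply: (mB (theta @^-1` K)).
  move=> j; have [N NK] := Kt j.*2; exists N => x /NK.
  by rewrite /theta /= interleave_even.
apply: card_le_trans kK _; apply: card_le_trans (card_image_le theta _).
by apply: subset_card_le => _ [[x _ <-] Kx]; exists x.
Qed.

(** * Functions not uniformly continuous on large sets *)

Theorem proposition2p1 (R : realType) (kappa lambda : Type)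
  (aleph1_kappa : aleph1_le kappa)
  (kappa_lambda : [set: kappa] #<= [set: lambda])
  (lambda_c : le_continuum lambda)
  (X Y : metricType R) (f : X -> Y)
  (X_separable : separable X)
  (X_card : [set: X] #= [set: lambda])
  (f_continuous : continuous f)
  (f_not_unif : forall A : set X, A #= [set: kappa] ->
     ~ unif_continuous (f : subspace A -> Y)) :
  (exists (P : topologicalType) (E : set P),
     [/\ polish R P, K_lusin kappa E & E #= [set: lambda]]) /\
  C9 R lambda kappa.
Proof.
have [m fm] := continuous_modulus f f_continuous.
(* A tame set that is not smaller than [kappa] would contain one of cardinality
   exactly [kappa], and [f] would be uniformly continuous there. *)
have m_tame B : tame m B -> ~ ([set: kappa] #<= B).
  move=> mB /card_subP[A Ak AB]; apply: (f_not_unif A Ak).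
  exact: modulus_unif_continuous fm (tame_subset AB mB).
split; last exact: C9_of_tame m_tame.
have [E [EK El]] := K_lusin_of_tame (R := R) m aleph1_kappa kappa_lambda X_card
  lambda_c m_tame.
by exists (baire R), E; split=> //; exact: baire_polish.
Qed.
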